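(* Let $M$ be a compact manifold and let $f:M\to M$ be a homeomorphism preserving an invariant (possibly singular) foliation $\mathcal F$ whose leaves are compact. Let $\mu$ be an $f$-invariant Borel probability measure on $M$ such that the singular set of $\mathcal F$ has $\mu$-measure zero. Let $\mathcal H$ be a class of observables (e.g. Hölder continuous functions). Suppose that the quotient map $F:M/\mathcal F\to M/\mathcal F$ has vertical decay with rate $\gamma_n$ and that $f$ has horizontal decay with rate $\delta_n$. Then for every $\psi,\varphi\in\mathcal H$ there is a constant $C_{\psi,\varphi}$ such that for all $n$, $$|\operatorname{Cor}_\mu(\psi,\varphi,f^n)|\le C_{\psi,\varphi}\max\{\gamma_n,\delta_n\}.$$
   Context: $\operatorname{Cor}_\mu(\psi,\varphi,f^n)=\int_M\psi\cdot(\varphi\circ f^n)\,d\mu-\int_M\psi\,d\mu\int_M\varphi\,d\mu$ for observables in $L^2(\mu)$. $F$ is the map induced by $f$ on the leaf space $M/\mathcal F$. The Rokhlin disintegration of $\mu$ is $\mu=\int\mu_l\,d\hat\mu(l)$, where $\hat\mu$ is a probability measure on $M/\mathcal F$ and each $\mu_l$ is a probability measure on the leaf $l$. For a leaf $l$ put $f_{n,l}=f^n|_l:l\to f^n(l)$. Rates $\gamma_n,\delta_n$ are sequences tending to $0$. Horizontal decay with rate $\delta_n$: for $\hat\mu$-almost every $l$ and all $\psi,\varphi\in\mathcal H$, $$\Bigl|\int_l\psi|_l\cdot(\varphi|_{f^n(l)}\circ f_{n,l})\,d\mu_l-\int_l\psi|_l\,d\mu_l\int_{f^n(l)}\varphi|_{f^n(l)}\,d\mu_{f^n(l)}\Bigr|\le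 C_{\psi,\varphi}\delta_n,$$ with $C_{\psi,\varphi}$ independent of $l$ and $n$. Vertical decay with rate $\gamma_n$: for $\psi\in\mathcal H$ let $\tilde\psi(l)=\int_l\psi|_l\,d\mu_l$; then for all $\psi,\varphi\in\mathcal H$, $$\Bigl|\int_{M/\mathcal F}\tilde\psi\cdot(\tilde\varphi\circ F^n)\,d\hat\mu-\int_{M/\mathcal F}\tilde\psi\,d\hat\mu\int_{M/\mathcal F}\tilde\varphi\,d\hat\mu\Bigr|\le C_{\psi,\varphi}\gamma_n.$$ *)

(* Defs.v *)
From HB Require Import structures.
From mathcomp Require Import all_boot all_order all_algebra generic_quotient.
From mathcomp Require Import all_classical all_reals all_analysis.

Set Implicit Arguments.
Unset Strict Implicit.
Unset Printing Implicit Defensive.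

Import Order.TTheory GRing.Theory Num.Theory.
Import numFieldNormedType.Exports.

Local Open Scope classical_set_scope.
Local Open Scope ring_scope.

Definition homeomorphism_on (T U : topologicalType) (A : set T) (B : set U)
    (f : T -> U) : Prop :=
  {within A, continuous f} /\
  exists g : U -> T,
    [/\ {within B, continuous g},
        forall x, A x -> B (f x) /\ g (f x) = x &
        forall y, B y -> A (g y) /\ f (g y) = y].

Definition homeomorphism (T U : topologicalType) (f : T -> U) : Prop :=
  homeomorphism_on [set: T] [set: U] f.

(* Every chart is taken onto the whole of R^m, which is no restriction since
   an open ball is homeomorphic to R^m. *)
Definition chart (R : realType) (m : nat) (M : topologicalType)
    (U : set M) (phi : M -> 'rV[R]_m) : Prop :=
  open U /\ homeomorphism_on U [set: 'rV[R]_m] phi.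

Definition compact_manifold (R : realType) (m : nat) (M : topologicalType) :
    Prop :=
  [/\ compact [set: M], hausdorff_space M, @second_countable M &
      forall x : M, exists U (phi : M -> 'rV[R]_m), U x /\ chart U phi].

Section Foliation.
Variables (R : realType) (m : nat) (M : ptopologicalType).

Definition eqclass (e : equiv_rel M) (x : M) : set M := [set y | e x y].

(* A foliated chart with k-dimensional plaques: inside U, the connected
   components of each leaf are the slices on which the last m - k coordinates
   are constant. *)
Definition foliated_chart (e : equiv_rel M) (k : nat)
    (U : set M) (phi : M -> 'rV[R]_m) : Prop :=
  [/\ (k <= m)%N, chart U phi &
      forall y, U y ->
        connected_component (U `&` eqclass e y) y =
        U `&` [set z | forall j : 'I_m, (k <= j)%N ->
                         phi z ord0 j = phi y ord0 j]].

(* The leaf dimension k may depend on the point (it is then locally constant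
   on the set of regular points). *)
Definition regular_point (e : equiv_rel M) (x : M) : Prop :=
  exists k U phi, U x /\ foliated_chart e k U phi.

(* A possibly singular foliation: a decomposition of M into connected leaves
   which is a foliation in the usual sense on a dense set of points; that set is
   open by construction.  It is a regular foliation when singular_set, defined
   below, is empty. *)
Record foliation : Type := Foliation {
  same_leaf : equiv_rel M;
  leaf_connected : forall x, connected (eqclass same_leaf x);
  regular_dense : dense [set x | regular_point same_leaf x]
}.

Definition leaf (F : foliation) (x : M) : set M := eqclass (same_leaf F) x.

Definition singular_set (F : foliation) : set M :=
  [set x | ~ regular_point (same_leaf F) x].

Definition invariant_foliation (F : foliation) (f : M -> M) : Prop :=
  forall x, f @` leaf F x = leaf F (f x).

End Foliation.

Definition borel (M : ptopologicalType) := g_sigma_algebraType (@open M).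

Section LeafSpace.
Variables (R : realType) (m : nat) (M : ptopologicalType).
Variable F : foliation R m M.
Local Open Scope quotient_scope.

Let quot := quotient_topology {eq_quot (same_leaf F)}.

(* M/F with the quotient sigma-algebra: B is measurable iff the union of the
   leaves in B is a Borel subset of M (this family is already a
   sigma-algebra). *)
Definition leaf_space :=
  @g_sigma_algebraType quot
    (image_set_system [set: M] (fun x : M => \pi_quot x)
       (@measurable _ (borel M))).

Definition leaf_proj (x : M) : leaf_space := \pi_quot x.

Definition leaf_of (l : leaf_space) : set M := [set x | leaf_proj x = l].

(* The choice of representative is immaterial when F is f-invariant, see
   induced_mapE. *)
Definition induced_map (f : M -> M) (l : leaf_space) : leaf_space :=
  leaf_proj (f (repr (l : quot))).

Lemma leaf_projE (x y : M) : leaf_proj x = leaf_proj y <-> leaf F x y.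
Proof. by split=> [/eqmodP|h]; last exact/eqmodP. Qed.

Lemma leaf_of_proj (x : M) : leaf_of (leaf_proj x) = leaf F x.
Proof.
apply/seteqP; split=> y /=; first by move=> h; apply/leaf_projE.
by move=> h; apply/esym/leaf_projE.
Qed.

Lemma induced_mapE (f : M -> M) (x : M) : invariant_foliation F f ->
  induced_map f (leaf_proj x) = leaf_proj (f x).
Proof.
move=> inv; apply/esym/leaf_projE; rewrite -inv.
exists (repr (leaf_proj x : quot)) => //.
by apply/leaf_projE/esym; exact: reprK.
Qed.

Section Decay.
Local Close Scope quotient_scope.
Variables (muhat : probability leaf_space R) (mu_ : R.-pker leaf_space ~> borel M).

(* mu = \int mu_l d muhat(l), with mu_l a probability measure carried by the
   leaf l.  These conditions force muhat to be the image of mu under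
   leaf_proj. *)
Definition disintegration (mu : probability (borel M) R) : Prop :=
  (forall l, mu_ l (leaf_of l) = 1%E) /\
  (forall A : set (borel M), measurable A ->
     mu A = (\int[muhat]_l mu_ l A)%E).

Definition leaf_average (psi : M -> R) (l : leaf_space) : R :=
  \int[mu_ l]_(x in leaf_of l) psi x.

Variables (f : M -> M) (H : set (M -> R)).

Definition vertical_decay (gamma : R^nat) : Prop :=
  exists C : (M -> R) -> (M -> R) -> R,
    (forall psi phi, 0 <= C psi phi) /\
    forall psi phi, H psi -> H phi -> forall n : nat,
      `| \int[muhat]_l (leaf_average psi l *
                        leaf_average phi (iter n (induced_map f) l))
         - (\int[muhat]_l leaf_average psi l) *
           (\int[muhat]_l leaf_average phi l) |
      <= C psi phi * gamma n.

Definition horizontal_decay (delta : R^nat) : Prop :=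
  exists C : (M -> R) -> (M -> R) -> R,
    (forall psi phi, 0 <= C psi phi) /\
    {ae muhat, forall l, forall psi phi, H psi -> H phi -> forall n : nat,
      let fnl := iter n (induced_map f) l in
      `| \int[mu_ l]_(x in leaf_of l) (psi x * phi (iter n f x))
         - (\int[mu_ l]_(x in leaf_of l) psi x) *
           (\int[mu_ fnl]_(x in leaf_of fnl) phi x) |
      <= C psi phi * delta n}.

End Decay.
End LeafSpace.

Definition invariant_measure (R : realType) (M : ptopologicalType)
    (f : M -> M) (mu : probability (borel M) R) : Prop :=
  forall A : set (borel M), measurable A -> mu (f @^-1` A) = mu A.

Definition Cor (R : realType) (M : ptopologicalType)
    (mu : probability (borel M) R) (psi phi : M -> R) (g : M -> M) : R :=
  \int[mu]_x (psi x * phi (g x))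
  - (\int[mu]_x psi x) * (\int[mu]_x phi x).

(* Main.v *)
Require Import Defs.
From mathcomp Require Import all_boot all_order all_algebra.
From mathcomp Require Import all_classical all_reals all_analysis.
From mathcomp Require Import measurable_realfun.

(* Disintegrating mu along the leaves turns the correlation into
     \int (c_n - a (b o F^n)) d muhat
       + (\int a (b o F^n) d muhat - \int a d muhat \int b d muhat),
   where a and b are the leaf averages of psi and phi, and c_n(l) is the
   integral of psi (phi o f^n) over the leaf l.  The integrand of the first term
   is bounded by horizontal decay for almost every leaf, the second term by
   vertical decay.  The product a (b o F^n) is integrable because it stays at
   bounded distance from the integrable function c_n. *)

Set Implicit Arguments.
Unset Strict Implicit.
Unset Printing Implicit Defensive.
Import Order.TTheory GRing.Theory Num.Theory.
Import numFieldNormedType.Exports.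
Local Open Scope classical_set_scope.
Local Open Scope ring_scope.

(** * Integration against a mixture of probability kernels *)

Section KernelMixture.
Context d d' (X : measurableType d) (Y : measurableType d') (R : realType).
Variables (nu : probability X R) (k : R.-pker X ~> Y).
Variable mu : {measure set Y -> \bar R}.
Hypothesis muE :
  forall A, measurable A -> mu A = (\int[nu]_x k x A)%E.
Local Open Scope ereal_scope.

Lemma ge0_integral_mixture (f : Y -> \bar R) :
  measurable_fun [set: Y] f -> (forall y, 0 <= f y) ->
  \int[mu]_y f y = \int[nu]_x \int[k x]_y f y.
Proof.
move=> mf f0.
(* Regarded as a constant kernel from [unit], [nu] composes with [k]; the composite agrees with [mu]
   by [muE], so the integral formula for composed kernels applies. *)
pose l : R.-pker unit ~> X := kprobability (@measurable_cst _ _ unit (pprobability X R) setT nu).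
have := @integral_kcomp _ _ _ _ _ _ R l (kernel.kernel_snd k) tt f f0 mf.
rewrite -[RHS]/(\int[nu]_x \int[k x]_y f y) => <-.
by apply: eq_measure_integral => A mA _; rewrite muE.
Qed.

Lemma measurable_kernel_integral (f : Y -> \bar R) :
  measurable_fun [set: Y] f -> measurable_fun setT (fun x => \int[k x]_y f y).
Proof.
move=> mf; under eq_fun do rewrite integralE.
by apply: emeasurable_funB; apply: measurable_fun_integral_kernel => //;
  [exact: measurable_kernel|exact: measurable_funepos
  |exact: measurable_kernel|exact: measurable_funeneg].
Qed.

(** The inner integral is dominated in absolute value by that of the absolute value of [f], whose
    [nu]-integral is finite by the nonnegative case. *)
Lemma integrable_kernel_integral (f : Y -> \bar R) :
  mu.-integrable setT f -> nu.-integrable setT (fun x => \int[k x]_y f y).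
Proof.
move=> fi; have mf := measurable_int _ fi.
apply/integrableP; split; first exact: measurable_kernel_integral.
move/integrableP : fi => [_]; rewrite ge0_integral_mixture//; last first.
  exact: measurableT_comp.
apply: le_lt_trans; apply: ge0_le_integral => //.
- by apply: measurableT_comp => //; exact: measurable_kernel_integral.
- by apply: measurable_kernel_integral; exact: measurableT_comp.
- by move=> x _; exact: le_abse_integral.
Qed.

Lemma integral_mixture (f : Y -> \bar R) :
  mu.-integrable setT f -> \int[mu]_y f y = \int[nu]_x \int[k x]_y f y.
Proof.
move=> fi; have mf := measurable_int _ fi.
rewrite integralE !ge0_integral_mixture//; last 2 first.
- exact: measurable_funeneg.
- exact: measurable_funepos.
rewrite -integralB//; last 2 first.
- exact/integrable_kernel_integral/integrable_funepos.
- exact/integrable_kernel_integral/integrable_funeneg.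
by apply: eq_integral => x _; rewrite /= [RHS]integralE.
Qed.

Lemma integrable_kernel_Rintegral (f : Y -> R) :
  mu.-integrable setT (EFin \o f) ->
  nu.-integrable setT (EFin \o (fun x => \int[k x]_y f y)%R).
Proof.
move=> fi; have ki := integrable_kernel_integral fi.
apply: le_integrable ki => //.
  apply/measurable_EFinP; apply: measurableT_comp => //.
  exact/measurable_kernel_integral/(measurable_int _ fi).
(* [fine] sends infinite values to 0, so it can only decrease the absolute value. *)
by move=> x _ /=; rewrite /Rintegral; case: (\int[k x]_y (f y)%:E) => //= *; exact: leey.
Qed.

Lemma Rintegral_mixture (f : Y -> R) : mu.-integrable [set: Y] (EFin \o f) ->
  (\int[mu]_y f y = \int[nu]_x \int[k x]_y f y)%R.
Proof.
move=> fi; have ki := integrable_kernel_integral fi.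
rewrite {1 2}/Rintegral (integral_mixture fi); congr fine.
(* The inner integral is finite for almost every [x], so [fine] alters it only on a null set. *)
apply: ae_eq_integral => //.
- exact: measurable_int ki.
- exact: measurable_int (integrable_kernel_Rintegral fi).
- by have := integrable_ae measurableT ki; apply: filterS => x /(_ Logic.I) xf _;
    rewrite /Rintegral fineK.
Qed.

End KernelMixture.

(** * Null sets and almost everywhere bounds *)

Lemma integral_carrier d (T : measurableType d) (R : realType)
    (mu : {measure set T -> \bar R}) (D : set T) (f : T -> \bar R) :
  measurable D -> mu (~` D) = 0%E -> measurable_fun [set: T] f ->
  (\int[mu]_(x in D) f x = \int[mu]_x f x)%E.
Proof.
move=> mD muD mf; rewrite integral_mkcond; apply: ae_eq_integral => //.
  exact/(measurable_restrictT _ mD).1/measurable_funTS.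
exists (~` D); split => //; first exact: measurableC.
by move=> x /= h Dx; apply: h => _; rewrite patchE mem_set.
Qed.

Lemma Rintegral_ae_bounded d (T : measurableType d) (R : realType)
    (P : probability T R) (f : T -> R) (c : R) :
  measurable_fun [set: T] f -> {ae P, forall x, `|f x| <= c} ->
  P.-integrable [set: T] (EFin \o f) /\ `|\int[P]_x f x| <= c.
Proof.
move=> mf fc.
have PT : (0 < P [set: T])%E by rewrite probability_setT.
(* A set of full measure in a probability space is nonempty, so the bound holds at some point and
   forces the sign of [c]. *)
have c0 : 0 <= c.
  have [x] := @filter_ex _ _ (ae_properfilter_algebraOfSetsType PT) _ fc.
  exact: le_trans.
have mEf : measurable_fun [set: T] (EFin \o f) by exact/measurable_EFinP.
have le_c : (\int[P]_x `|(f x)%:E| <= c%:E)%E.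
  rewrite -[leRHS]mule1 -(probability_setT P) -integral_cst//.
  apply: ae_ge0_le_integral => //; first exact: measurableT_comp.
  by apply: filterS fc => x fx _; rewrite lee_fin.
have fi : P.-integrable [set: T] (EFin \o f).
  by apply/integrableP; split=> //; apply: le_lt_trans le_c _; rewrite ltry.
split=> //; apply: le_trans (le_normr_Rintegral measurableT fi) _.
by rewrite -lee_fin fineK// ge0_fin_numE ?integral_ge0// (le_lt_trans le_c) ?ltry.
Qed.

(** The difference is almost everywhere bounded, hence integrable, so [g], being [f] minus that
    difference, inherits integrability; the two integrals can then be subtracted. *)
Lemma Rintegral_ae_close d (T : measurableType d) (R : realType)
    (P : probability T R) (f g : T -> R) (c : R) :
  P.-integrable [set: T] (EFin \o f) -> measurable_fun [set: T] g ->
  {ae P, forall x, `|f x - g x| <= c} ->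
  `|\int[P]_x f x - \int[P]_x g x| <= c.
Proof.
move=> fi mg fgc.
have mf : measurable_fun [set: T] f by have /measurable_EFinP := measurable_int _ fi.
have [di dc] := Rintegral_ae_bounded (measurable_funB mf mg) fgc.
have gi : P.-integrable [set: T] (EFin \o g).
  rewrite (_ : _ \o _ = (EFin \o f) \- (EFin \o (f \- g)%R))%E.
    exact: integrableB.
  by apply/funext => x /=; rewrite -EFinB opprB addrC subrK.
by rewrite -RintegralB.
Qed.

(** * Composition with measure-preserving maps *)

Section MeasurePreserving.
Context d (T : measurableType d) (R : realType) (mu : {measure set T -> \bar R}).
Context (g : T -> T) (mg : measurable_fun [set: T] g).
Hypothesis mu_g : forall A, measurable A -> mu (g @^-1` A) = mu A.

Lemma Lfun_comp_preserving (p : R) (f : T -> R) :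
  f \in Lfun mu p%:E -> f \o g \in Lfun mu p%:E.
Proof.
rewrite !inE => /andP[]; rewrite !inE /= => mf ff.
have mfg : measurable_fun [set: T] (f \o g) by exact: measurableT_comp.
apply/andP; split; rewrite inE //=.
rewrite /finite_norm !unlock in ff *.
(* The norm depends on the function only through this integral; a change of variables moves [g] into
   the pushforward measure, which is [mu] again by [mu_g]. *)
suff -> : (\int[mu]_x `|(EFin \o (f \o g)) x| `^ p =
           \int[mu]_x `|(EFin \o f) x| `^ p)%E by [].
pose h x := (`|(EFin \o f) x| `^ p)%E.
have mh : measurable_fun [set: T] h.
  apply: (measurableT_comp (measurable_poweR _)); apply: measurableT_comp => //.
  exact/measurable_EFinP.
transitivity (\int[pushforward mu g]_x h x)%E.
  by rewrite ge0_integral_pushforward// => x _; exact: poweR_ge0.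
by apply: eq_measure_integral => A mA _; exact: mu_g.
Qed.

End MeasurePreserving.

Lemma measurable_homeomorphism (M : ptopologicalType) (f : M -> M) :
  homeomorphism f -> measurable_fun [set: borel M] (f : borel M -> borel M).
Proof.
move=> [cw _]; have cf : continuous f.
  by move: cw; rewrite continuous_open_subspace => [cf x|]; [exact: cf (in_setT x)|exact: openT].
apply: (@measurability _ _ (borel M) (borel M) setT f (@open M) erefl).
move=> _ [A oA <-]; rewrite setTI; apply: sub_sigma_algebra.
by move/continuousP : cf; exact.
Qed.

(** * Measurability on the leaf space *)

Section LeafSpaceMeasurability.
Context (R : realType) (m : nat) (M : ptopologicalType) (F : foliation R m M).

(** Preimages commute with set operations, so having a Borel preimage passes from the generators to
    every measurable set; generation adds no new sets. *)
Lemma measurable_leaf_spaceP (B : set (leaf_space F)) :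
  measurable B <-> measurable (@leaf_proj R m M F @^-1` B : set (borel M)).
Proof.
split=> [mB|mB]; last by apply: sub_sigma_algebra => /=; rewrite /image_set_system /= setTI.
suff H : measurable_fun [set: borel M] (@leaf_proj R m M F : borel M -> _).
  by have := H measurableT B mB; rewrite setTI.
apply: (@measurability _ _ (borel M) (leaf_space F) setT (@leaf_proj R m M F)
  (image_set_system setT (@leaf_proj R m M F) (@measurable _ (borel M))) erefl).
by move=> _ [A mA <-].
Qed.

(** By invariance [leaf_proj] semiconjugates [f] to the induced map, so the set to test in [M] is
    the [f]-preimage of a Borel set. *)
Lemma measurable_induced_map (f : M -> M) :
  measurable_fun [set: borel M] (f : borel M -> borel M) ->
  invariant_foliation F f ->
  measurable_fun [set: leaf_space F] (@induced_map R m M F f : _ -> leaf_space F).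
Proof.
move=> mf inv _ B /measurable_leaf_spaceP mB; rewrite setTI.
apply/measurable_leaf_spaceP.
rewrite (_ : _ @^-1` _ = f @^-1` (@leaf_proj R m M F @^-1` B)).
  by have := mf measurableT _ mB; rewrite setTI.
by apply/seteqP; split=> x /=; rewrite induced_mapE.
Qed.

(** A compact leaf is closed in a Hausdorff space, hence Borel. *)
Lemma measurable_leaf_of (l : leaf_space F) :
  hausdorff_space M -> (forall x, compact (leaf F x)) ->
  measurable (leaf_of l : set (borel M)).
Proof.
move=> hM cF.
have -> : l = leaf_proj F (repr l).
  by apply/esym; exact: reprK.
rewrite leaf_of_proj; rewrite -[X in measurable X]setCK.
apply: measurableC; apply: sub_sigma_algebra; apply: closed_openC.
exact: compact_closed.
Qed.

End LeafSpaceMeasurability.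

Section Iterates.
Context d (T : measurableType d) (f : T -> T) (mf : measurable_fun [set: T] f).

Lemma measurable_iter (n : nat) : measurable_fun [set: T] (iter n f).
Proof.
by elim: n => [|n IHn]; [exact: measurable_id|exact: measurableT_comp].
Qed.

Lemma iter_preserving (R : realType) (mu : set T -> \bar R) (n : nat) :
  (forall A, measurable A -> mu (f @^-1` A) = mu A) ->
  forall A, measurable A -> mu (iter n f @^-1` A) = mu A.
Proof.
move=> mu_f; elim: n => [//|n IHn] A mA.
rewrite -[RHS]mu_f// -[RHS]IHn//.
by have := mf measurableT mA; rewrite setTI.
Qed.

End Iterates.

(** * Correlations disintegrated along the leaves *)

Theorem proposition2 (R : realType) (m : nat) (M : ptopologicalType)
  (M_manifold : compact_manifold R m M)
  (f : M -> M) (f_homeo : homeomorphism f)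
  (F : foliation R m M)
  (F_invariant : invariant_foliation F f)
  (F_compact : forall x : M, compact (leaf F x))
  (mu : probability (borel M) R)
  (mu_invariant : invariant_measure f mu)
  (mu_singular : mu (singular_set F) = 0%E)
  (muhat : probability (leaf_space F) R)
  (mu_ : R.-pker leaf_space F ~> borel M)
  (mu_disintegration : disintegration muhat mu_ mu)
  (H : set (M -> R))
  (H_L2 : forall psi, H psi -> psi \in @Lfun _ (borel M) R mu 2%:E)
  (gamma delta : R^nat)
  (gamma_rate : gamma n @[n --> \oo] --> 0)
  (delta_rate : delta n @[n --> \oo] --> 0)
  (F_vertical : vertical_decay muhat mu_ f H gamma)
  (f_horizontal : horizontal_decay muhat mu_ f H delta) :
  forall psi phi : M -> R, H psi -> H phi ->
    exists C : R, 0 <= C /\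
      forall n : nat,
        `| Cor mu psi phi (fun x => iter n f x) |
        <= C * Num.max (gamma n) (delta n).

Proof.
have [_ hM _ _] := M_manifold.
have mf := measurable_homeomorphism f_homeo.
have mF := measurable_induced_map mf F_invariant.
have [mu_leaf muE] := mu_disintegration.
have mu_T l : mu_ l setT = 1%E by exact: prob_kernel.
(* With this, the leaf integrals in the decay hypotheses may be taken over all of [M], where the
   mixture formulas apply. *)
have carrier l : mu_ l (~` leaf_of l) = 0%E.
  have mL := measurable_leaf_of l hM F_compact.
  rewrite -setTD.
  have -> : mu_ l (setT `\` leaf_of l) = (mu_ l setT - mu_ l (setT `&` leaf_of l))%E.
    by apply: measureD => //; apply: le_lt_trans (ltry 1); rewrite -(mu_T l).
  by rewrite setTI mu_T mu_leaf subee.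
have Rint_leaf l (g : M -> R) : measurable_fun [set: borel M] (g : borel M -> R) ->
    \int[mu_ l]_(x in leaf_of l) g x = \int[mu_ l]_x g x.
  move=> mg; congr fine; apply: integral_carrier => //.
    exact: measurable_leaf_of.
  exact/measurable_EFinP.
have L2_measurable g : g \in @Lfun _ (borel M) R mu 2%:E ->
    measurable_fun [set: borel M] (g : borel M -> R).
  by rewrite inE => /andP[]; rewrite inE.
have L2_integrable g : g \in @Lfun _ (borel M) R mu 2%:E ->
    mu.-integrable [set: borel M] (EFin \o g).
  move=> g2; apply/Lfun1_integrable; apply: Lfun_subset12 => //.
  exact: fin_num_measure.
have avgE g : g \in @Lfun _ (borel M) R mu 2%:E ->
    leaf_average mu_ g = fun l => \int[mu_ l]_x g x.
  by move=> /L2_measurable mg; apply/funext => l; exact: Rint_leaf.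
have avg_int g : g \in @Lfun _ (borel M) R mu 2%:E ->
    muhat.-integrable [set: leaf_space F] (EFin \o leaf_average mu_ g).
  by move=> g2; rewrite avgE//; apply: (integrable_kernel_Rintegral muE); exact: L2_integrable.
have avg_mean g : g \in @Lfun _ (borel M) R mu 2%:E ->
    \int[muhat]_l leaf_average mu_ g l = \int[mu]_x g x.
  by move=> g2; rewrite avgE// (Rintegral_mixture muE)//; exact: L2_integrable.
move=> psi phi Hpsi Hphi.
have [psi2 phi2] := (H_L2 psi Hpsi, H_L2 phi Hphi).
have [C1 [C1_ge0 hor]] := f_horizontal.
have [C2 [C2_ge0 ver]] := F_vertical.
(* One constant for each decay estimate; being nonnegative, they allow each rate to be replaced by
   the maximum. *)
exists (C1 psi phi + C2 psi phi); split; first exact: addr_ge0.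
move=> n.
pose a := leaf_average mu_ psi; pose b := leaf_average mu_ phi.
pose Fn := iter n (@induced_map R m M F f).
pose c l := \int[mu_ l]_x (psi x * phi (iter n f x)).
(* Invariance of [mu] keeps the composite in L2, so its product with [psi] is integrable. *)
have phin2 : phi \o iter n f \in @Lfun _ (borel M) R mu 2%:E.
  apply: (@Lfun_comp_preserving _ (borel M)) => //; first exact: measurable_iter.
  exact: iter_preserving.
have prod_int : mu.-integrable [set: borel M]
    (EFin \o (fun x => psi x * phi (iter n f x))).
  exact/Lfun1_integrable/Lfun2_mul_Lfun1.
have c_int : muhat.-integrable [set: leaf_space F] (EFin \o c).
  exact: (integrable_kernel_Rintegral muE).
have mRint (h : leaf_space F -> R) : muhat.-integrable [set: leaf_space F] (EFin \o h) ->
    measurable_fun [set: leaf_space F] h.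
  by move=> /measurable_int/measurable_EFinP.
(* Measurability is all that [Rintegral_ae_close] asks of this product. *)
have mab : measurable_fun [set: leaf_space F] (fun l => a l * b (Fn l)).
  apply: measurable_funM; first exact: mRint _ (avg_int _ psi2).
  exact: measurableT_comp (mRint _ (avg_int _ phi2)) (measurable_iter mF n).
(* The horizontal bound is uniform in the leaf, so it survives integration against the probability
   [muhat]. *)
have d_le : `|\int[muhat]_l c l - \int[muhat]_l (a l * b (Fn l))| <=
    C1 psi phi * delta n.
  apply: Rintegral_ae_close => //.
  apply: filterS hor => l /(_ psi phi Hpsi Hphi n) /=.
  by rewrite Rint_leaf//; apply: measurable_funM; exact: L2_measurable.
(* The integral of [a l * b (Fn l)] is added and subtracted; the mixture formula identifies the
   other terms with integrals over [M]. *)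
have CorE : Cor mu psi phi (fun x => iter n f x) =
    (\int[muhat]_l c l - \int[muhat]_l (a l * b (Fn l))) +
    (\int[muhat]_l (a l * b (Fn l)) -
     (\int[muhat]_l a l) * (\int[muhat]_l b l)).
  rewrite addrA subrK /Cor (Rintegral_mixture muE prod_int).
  by rewrite !avg_mean.
rewrite CorE; apply: le_trans (ler_normD _ _) _; rewrite mulrDl.
apply: lerD.
  by apply: le_trans d_le _; apply: ler_wpM2l => //; rewrite le_max lexx orbT.
apply: le_trans (ver psi phi Hpsi Hphi n) _.
by apply: ler_wpM2l => //; rewrite le_max lexx.
Qed.
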